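(* Let $R$ be a field and let $V$ be a vector space over $R$ of finite dimension $n\ge 2$. Let $G$ be a subgroup of $\mathrm{PGL}(V)$ isomorphic to the symmetric group $S_{m}$. Let $\mathcal{X}\subset\mathcal{P}(V)$ be an orbit of $G$ such that $G$ acts faithfully on $\mathcal{X}$ and $|\mathcal{X}|=m$. Suppose that there are no $G$-invariant subspaces of $V$ other than $\{0\}$ and $V$. Then the following assertions hold: (1) $\mathcal{X}$ is a maximal independent subset, or $\mathcal{X}$ is an $n$-simplex, or $\mathcal{X}$ is a harmonic subset and the characteristic of $R$ is equal to $3$; (2) if $\mathcal{X}$ is not independent, then $G=G(\mathcal{X})$.
   Context: $S_m$ is the group of permutations of $m$ letters. $\mathcal{P}(V)$ is the set of $1$-dimensional subspaces of $V$, and for a subspace $S\subset V$, $\mathcal{P}(S)\subset\mathcal{P}(V)$ is the set of $1$-dimensional subspaces of $S$. $\mathrm{PGL}(V)$ is the group of transformations of $\mathcal{P}(V)$ induced by linear automorphisms of $V$. A subspace $S\subset V$ is $G$-invariant (for $G\le\mathrm{PGL}(V)$) if every element of $G$ transfers $\mathcal{P}(S)$ to itself. Distinct elements $P_{1},\dots,P_{k}\in\mathcal{P}(V)$ form an independent subset if non-zero vectors $x_{1}\in P_{1},\dots,x_{k}\in P_{k}$ are linearly independent. A maximal independent subset is an independent subset consisting of $n$ elements. An $n$-simplex is an $(n+1)$-element subset of $\mathcal{P}(V)$ that is not independent and all of whose $n$-element subsets are independent. A subset $\mathcal{X}\subset\mathcal{P}(V)$ is called harmonic if there are linearly independent vectors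 $x,y\in V$ such that $\mathcal{X}=\{\langle x\rangle,\langle y\rangle,\langle x+y\rangle,\langle x-y\rangle\}$, where $\langle\cdot\rangle$ denotes linear span. Definition of $G(\mathcal{X})$: suppose that $\mathcal{X}$ is an $n$-simplex, or that $R$ has characteristic $3$, $\mathcal{X}$ is a harmonic subset and no proper subspace of $V$ contains every element of $\mathcal{X}$ (so $n=2$). Then every permutation $s$ of $\mathcal{X}$ has a unique extension $\overline{s}\in\mathrm{PGL}(V)$ (i.e. $\overline{s}(P)=s(P)$ for all $P\in\mathcal{X}$), and $s\mapsto\overline{s}$ is an injective homomorphism from the group $S(\mathcal{X})$ of all permutations of $\mathcal{X}$ to $\mathrm{PGL}(V)$. Its image is denoted by $G(\mathcal{X})$. The assertion $G=G(\mathcal{X})$ includes the assertion that $\mathcal{X}$ satisfies these conditions, so that $G(\mathcal{X})$ is defined. *)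

(* Defs.v *)
From HB Require Import structures.
From mathcomp Require Import all_boot all_order all_algebra all_fingroup.
From mathcomp Require Import finmap.
From mathcomp Require Import boolp classical_sets functions.

Set Implicit Arguments.
Unset Strict Implicit.
Unset Printing Implicit Defensive.

Import GRing.Theory.
Local Open Scope ring_scope.

Section ProjectiveLinearGroup.
Variables (R : fieldType) (V : vectType R).

Definition proj_point : Type := {U : {vspace V} | \dim U == 1%N}.

HB.instance Definition _ := SubChoice.on proj_point.

Definition proj_points (S : {vspace V}) : set proj_point :=
  [set P : proj_point | (val P <= S)%VS].

Definition projectivity (f : proj_point -> proj_point) : Prop :=
  exists2 g : 'End(V), lker g == 0%VS & forall P, val (f P) = (g @: val P)%VS.

Record PGL : Type := MkPGL {
  PGL_fun :> proj_point -> proj_point;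
  PGL_funP : `[< projectivity PGL_fun >] }.

HB.instance Definition _ := [isSub for PGL_fun].
HB.instance Definition _ := [Choice of PGL by <:].

Lemma PGL_ext (f g : PGL) : f =1 g -> f = g.
Proof. by move=> fg; apply/val_inj/funext. Qed.

Fact PGL_one_subproof : `[< projectivity (@id proj_point) >].
Proof.
apply/asboolP; exists \1%VF => [|P]; last by rewrite lim1g.
by apply/lker0P => x y; rewrite !id_lfunE.
Qed.
Definition PGL_one : PGL := MkPGL PGL_one_subproof.

Fact PGL_mul_subproof (f g : PGL) : `[< projectivity (f \o g) >].
Proof.
have /asboolP[u /lker0P u_inj fu] := PGL_funP f.
have /asboolP[v /lker0P v_inj gv] := PGL_funP g.
apply/asboolP; exists (u \o v)%VF => [|P]; last by rewrite /= fu gv limg_comp.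
by apply/lker0P => x y; rewrite !comp_lfunE => /u_inj/v_inj.
Qed.
Definition PGL_mul (f g : PGL) : PGL := MkPGL (PGL_mul_subproof f g).

Fact PGL_inv_subproof (f : PGL) : exists h : PGL, cancel f h /\ cancel h f.
Proof.
have /asboolP[u u0 fu] := PGL_funP f.
have uVu : (u^-1 \o u)%VF = \1%VF by apply: lker0_compVf.
have uuV : (u \o u^-1)%VF = \1%VF by apply: lker0_compfV.
have v0 : lker (u^-1)%VF == 0%VS.
  by apply/lker0P; apply: can_inj (lker0_lfunVK u0).
have dimV (P : proj_point) : \dim ((u^-1)%VF @: val P) == 1%N.
  by rewrite limg_dim_eq ?(valP P) // (eqP v0) capv0.
pose h (P : proj_point) : proj_point :=
  exist (fun U => \dim U == 1%N) _ (dimV P).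
have hP : `[< projectivity h >] by apply/asboolP; exists (u^-1)%VF.
by exists (MkPGL hP); split=> P; apply: val_inj;
  rewrite /= ?fu /= -limg_comp ?uVu ?uuV lim1g.
Qed.
Definition PGL_inv (f : PGL) : PGL := sval (cid (PGL_inv_subproof f)).

Fact PGL_mulA : associative PGL_mul.
Proof. by move=> f g h; apply: PGL_ext. Qed.
Fact PGL_mul1 : left_id PGL_one PGL_mul.
Proof. by move=> f; apply: PGL_ext. Qed.
Fact PGL_mulr1 : right_id PGL_one PGL_mul.
Proof. by move=> f; apply: PGL_ext. Qed.
Fact PGL_mulV : left_inverse PGL_one PGL_inv PGL_mul.
Proof.
by move=> f; apply: PGL_ext; rewrite /PGL_inv; case: cid => h [].
Qed.
Fact PGL_mulrV : right_inverse PGL_one PGL_inv PGL_mul.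
Proof.
by move=> f; apply: PGL_ext; rewrite /PGL_inv; case: cid => h [].
Qed.

HB.instance Definition _ :=
  isGroup.Build PGL PGL_mulA PGL_mul1 PGL_mulr1 PGL_mulV PGL_mulrV.

End ProjectiveLinearGroup.

Arguments proj_points {R V} S.

Section Configurations.
Variables (R : fieldType) (V : vectType R).
Implicit Types (G : set (PGL V)) (X : {fset proj_point V}).

(* MathComp composes permutations from left to right and PGL is composed from
   right to left; as every group is isomorphic to its opposite, this does not
   affect the existence of an isomorphism. *)
Definition isomorphic_to_Sym G (m : nat) : Prop :=
  exists2 phi : {multiplicative 'S_m -> PGL V},
    injective phi & range phi = G.

Definition PGL_orbit G (P : proj_point V) : set (proj_point V) :=
  [set (g : PGL V) P | g in G].

Definition acts_faithfully G X : Prop :=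
  forall g, G g -> (forall P, P \in X -> g P = P) -> g = 1%g.

Definition PGL_invariant G (S : {vspace V}) : Prop :=
  forall g : PGL V, G g -> (g @` proj_points S)%classic = proj_points S.

Definition independent X : Prop :=
  forall x : proj_point V -> V,
    (forall P, P \in X -> x P \in val P /\ x P != 0) ->
    free [seq x P | P <- X].

Definition maximal_independent X : Prop :=
  independent X /\ #|` X| = \dim {:V}.

(* The n-simplices, for n the dimension of V. *)
Definition simplex X : Prop :=
  [/\ #|` X| = (\dim {:V}).+1,
      ~ independent X
    & forall Y : {fset proj_point V}, (Y `<=` X)%fset -> #|` Y| = \dim {:V} ->
        independent Y].

(* The equality is between sets of subspaces: val forgets that the elements of
   X have dimension 1. *)
Definition harmonic X : Prop :=
  exists x y : V, free [:: x; y] /\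
    [fset val P | P in X]%fset
      = [fset <[x]>%VS; <[y]>%VS; <[x + y]>%VS; <[x - y]>%VS]%fset.

Definition not_in_proper_subspace X : Prop :=
  forall S : {vspace V}, (forall P, P \in X -> proj_points S P) -> S = fullv.

Definition has_GX X : Prop :=
  simplex X \/
  [/\ 3%N \in [pchar R], harmonic X & not_in_proper_subspace X].

Definition extends X (g : PGL V) (s : {perm X}) : Prop :=
  forall P : X, g (val P) = val (s P).

(* When has_GX X holds, every s has exactly one extension, so that this is the
   image of the map sending s to its extension. *)
Definition GX X : set (PGL V) := [set g | exists s : {perm X}, extends g s].

Definition is_GX G X : Prop := has_GX X /\ G = GX X.

End Configurations.

(* Main.v *)
(* Comparing orders, G induces every permutation of X. As X spans V, some
   n points of X form a basis, hence by symmetry any n points of X do. If X is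
   not independent, choose n + 1 of its points and scale representatives so that
   these points are <x_1>, ..., <x_n> and <x_1 + ... + x_n>; only the identity
   of PGL(V) fixes them all. If X contains nothing else, it is a simplex. It
   cannot contain two further points, since their transposition would be
   trivial. If it contains one further point Q', the transposition of <x_i> and
   <x_j> is induced by the permutation of the coordinates i and j and fixes Q';
   as the coordinates of Q' are distinct and non-zero, this forces n = 2 and
   Q' = <x_1 - x_2>. Then the transposition of <x_1> and <x_1 + x_2> must fix
   <x_2> and <x_1 - x_2>, and this forces 3 = 0. *)
Require Import Defs.
From mathcomp Require Import all_boot all_order all_algebra all_fingroup.
From mathcomp Require Import primitive_action alt.
From mathcomp Require Import finmap.
From mathcomp Require Import boolp classical_sets functions.

Set Implicit Arguments.
Unset Strict Implicit.
Unset Printing Implicit Defensive.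

Import GRing.Theory.
Local Open Scope ring_scope.

(** * Permutations and images of finite sets *)

(** The symmetric group of [T] is transitive on tuples of [#|T|] distinct elements, hence also on
    shorter ones. *)
Lemma perm_map_seq (T : finType) (s t : seq T) :
  uniq s -> uniq t -> size s = size t ->
  exists p : {perm T}, map p s = t.
Proof.
move=> us ut st; have := Sym_trans T.
have le_s : (size s <= #|T|)%N by rewrite -(card_uniqP us) max_card.
move/(ntransitive_weak le_s) => tr.
have ds : in_tuple s \in (size s).-dtuple([set: T]).
  by rewrite inE /= us; apply/fintype.subsetP => x _; rewrite inE.
pose t' : (size s).-tuple T := Tuple (introT eqP (esym st)).
have dt : t' \in (size s).-dtuple([set: T]).
  by rewrite inE /= ut; apply/fintype.subsetP => x _; rewrite inE.
have [p _ /(congr1 val) /= tE] := atransP2 tr ds dt.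
by exists p; rewrite tE.
Qed.

Lemma imfset4 (K K' : choiceType) (f : K -> K') (A : {fset K}) (a b c d : K) :
  a \in A -> b \in A -> c \in A -> d \in A ->
  (forall z, z \in A -> [\/ z = a, z = b, z = c | z = d]) ->
  [fset f z | z in A]%fset = [fset f a; f b; f c; f d]%fset.
Proof.
move=> aA bA cA dA A4; apply/fsetP => y; rewrite !inE -!orbA.
apply/imfsetP/idP => [[z /= /A4[]-> ->]|/or4P[]/eqP->]; rewrite ?eqxx ?orbT //.
- by exists a.
- by exists b.
- by exists c.
- by exists d.
Qed.

(** * Points, joins and independence *)

Section Points.
Variables (R : fieldType) (V : vectType R).
Implicit Types (P Q : proj_point V) (s t : seq (proj_point V)) (g : PGL V).

Lemma line_eq P (x : V) : x \in val P -> x != 0 -> val P = <[x]>%VS.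
Proof.
move=> xP x0; apply/eqP; rewrite eq_sym eqEdim -memvE xP dim_vline x0.
by rewrite (eqP (valP P)).
Qed.

Lemma proj_pointP P : exists2 x : V, x != 0 & val P = <[x]>%VS.
Proof.
have x0 : vpick (val P) != 0 by rewrite vpick0 -dimv_eq0 (eqP (valP P)).
by exists (vpick (val P)) => //; apply: line_eq (memv_pick _) x0.
Qed.

Definition join s : {vspace V} := (\sum_(P <- s) val P)%VS.

Lemma join_cons P s : join (P :: s) = (val P + join s)%VS.
Proof. by rewrite /join big_cons. Qed.

Lemma sub_join P s : P \in s -> (val P <= join s)%VS.
Proof.
elim: s => // Q s IHs; rewrite inE join_cons => /orP[/eqP->|/IHs].
  exact: addvSl.
by move/subv_trans; apply; apply: addvSr.
Qed.

Lemma join_sub s (U : {vspace V}) :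
  (forall P, P \in s -> (val P <= U)%VS) -> (join s <= U)%VS.
Proof.
move=> sU; rewrite /join big_seq; elim/big_rec: _ => [|P W Ps WU].
  exact: sub0v.
by rewrite subv_add sU.
Qed.

Lemma dim_join_le s : (\dim (join s) <= size s)%N.
Proof.
apply: leq_trans (dimv_leq_sum _ _ _) _.
by under eq_bigr => P _ do rewrite (eqP (valP P)); rewrite sum1_size.
Qed.

(** Whatever the choice of representatives, they span [join Y]; so freeness is a dimension count and
    does not depend on the choice. *)
Lemma independentP (Y : {fset proj_point V}) :
  independent Y <-> \dim (join Y) = #|` Y|%fset.
Proof.
have spanE (x : proj_point V -> V) :
    (forall P, P \in Y -> x P \in val P /\ x P != 0) ->
  <<[seq x P | P <- Y]>>%VS = join Y.
  move=> xP; rewrite span_def big_map; apply: eq_big_seq => P /xP[xP1 xP0].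
  by rewrite -(line_eq xP1 xP0).
split=> [indY | dimY x xP]; last by rewrite /free spanE // size_map dimY.
have xP P : P \in Y -> vpick (val P) \in val P /\ vpick (val P) != 0.
  by move=> _; rewrite memv_pick vpick0 -dimv_eq0 (eqP (valP P)).
by have := indY _ xP; rewrite /free spanE // size_map => /eqP.
Qed.

(** Greedy choice: a point is kept only if it lies outside the join of those kept so far. A line not
    contained in a subspace meets it in 0, so each kept point raises the dimension by one. *)
Lemma exists_basis s : exists t,
  [/\ subseq t s, join t = join s & \dim (join t) = size t].
Proof.
elim: s => [|P s [t [ts jt dt]]].
  by exists [::]; rewrite /join big_nil dimv0.
have [Pt|nPt] := boolP (val P <= join t)%VS.
  exists t; split=> //; first exact: subseq_trans ts (subseq_cons _ _).
  by rewrite join_cons -jt; apply/esym/addv_idPr.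
exists (P :: t); split; rewrite /= ?eqxx ?join_cons ?jt //.
rewrite dimv_disjoint_sum -?jt ?dt ?(eqP (valP P)) //.
apply/eqP; rewrite -dimv_eq0; apply: contraR nPt => nz.
suff /eqP <- : (val P :&: join t)%VS == val P by apply: capvSr.
by rewrite eqEdim capvSl (eqP (valP P)) lt0n.
Qed.

(** * Projectivities through their linear lifts *)

Lemma PGL_linear g : exists2 u : 'End(V),
  lker u == 0%VS & forall P, val (g P) = (u @: val P)%VS.
Proof. by have /asboolP := PGL_funP g. Qed.

Lemma limg_join (u : 'End(V)) g s : (forall P, val (g P) = (u @: val P)%VS) ->
  (u @: join s)%VS = join (map g s).
Proof.
by move=> gu; rewrite limg_sum /join big_map; apply: eq_bigr => P _; rewrite gu.
Qed.

Lemma dim_join_map g s : \dim (join (map g s)) = \dim (join s).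
Proof.
have [u u0 gu] := PGL_linear g; rewrite -(limg_join s gu) limg_dim_eq //.
by rewrite (eqP u0) capv0.
Qed.

Lemma PGL_inj g : injective g.
Proof.
apply: (can_inj (g := (g^-1)%g)) => P.
(* The product of [PGL V] is composition up to conversion, so iterated values can be read as values
   of a product. *)
by rewrite -[LHS]/((g^-1 * g)%g P) mulVg.
Qed.

Lemma PGL_lineP (u : 'End(V)) g P Q x y :
  lker u == 0%VS -> (forall P, val (g P) = (u @: val P)%VS) ->
  g P = Q -> val P = <[x]>%VS -> val Q = <[y]>%VS ->
  exists k, u x = k *: y.
Proof.
move=> u0 gu <- Px; rewrite gu Px limg_line => E.
by apply/vlineP; rewrite -E memv_line.
Qed.

(** * Projective frames *)

(** Reindexing by [p] writes both sides over the vectors [x (p i)], whose coefficients [l i] and [c]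
    must then agree. *)
Lemma frame_scalar n (x : 'I_n -> V) (u : 'End(V)) (p : 'S_n)
    (l : 'I_n -> R) (c : R) :
  (forall k : 'I_n -> R, \sum_i k i *: x i = 0 -> forall i, k i = 0) ->
  (forall i, u (x i) = l i *: x (p i)) ->
  u (\sum_i x i) = c *: \sum_i x i -> forall i, l i = c.
Proof.
move=> xfree ux; rewrite linear_sum [X in _ *: X](reindex_inj (@perm_inj _ p)) /=.
rewrite scaler_sumr => /eqP; rewrite -subr_eq0 -sumrB => E i.
have := xfree (fun j => l ((p^-1)%g j) - c); rewrite (reindex_inj (@perm_inj _ p)).
move=> H; have {H} := H _ (p i); rewrite permK => H.
apply/eqP; rewrite -subr_eq0; apply/eqP/H.
rewrite -[RHS](eqP E); apply: eq_bigr => j _.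
by rewrite permK ux scalerBl.
Qed.

(** A projective coordinate system with unit point [Q]. The last two clauses say that [x] is a
    basis, in the form in which coefficients are compared later. *)
Definition frame n (s : n.-tuple (proj_point V)) Q (x : 'I_n -> V) : Prop :=
  [/\ forall i, val (tnth s i) = <[x i]>%VS,
      val Q = <[\sum_i x i]>%VS,
      forall k : 'I_n -> R, \sum_i k i *: x i = 0 -> forall i, k i = 0
    & forall v, exists k : 'I_n -> R, v = \sum_i k i *: x i].

(** Fixing the unit point forces the scalars of [u] on the [x i] to coincide, so up to one scalar
    [u] permutes coordinates. That scalar is non-zero because [u] is injective and the unit vector
    is not 0. *)
Lemma frame_perm n (s : n.-tuple (proj_point V)) Q x g (u : 'End(V)) (p : 'S_n) :
  frame s Q x -> lker u == 0%VS -> (forall P, val (g P) = (u @: val P)%VS) ->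
  (forall i, g (tnth s i) = tnth s (p i)) -> g Q = Q ->
  exists2 c : R, c != 0 & forall i, u (x i) = c *: x (p i).
Proof.
move=> [sx Qx xfree _] u0 gu gs gQ.
have [c uc] := PGL_lineP u0 gu gQ Qx Qx.
have /choice[l ul] i : exists k, u (x i) = k *: x (p i).
  exact: (PGL_lineP u0 gu (gs i) (sx i) (sx (p i))).
have lc := frame_scalar xfree ul uc.
exists c => [|i]; last by rewrite ul lc.
apply: contraTneq (valP Q) => c0; rewrite Qx dim_vline.
suff -> : \sum_i x i = 0 by rewrite eqxx.
move/lker0P: u0; apply; rewrite linear0 linear_sum big1 //= => i _.
by rewrite ul lc c0 scale0r.
Qed.

(** For the identity permutation, [frame_perm] makes [u] a homothety, which fixes every line. *)
Lemma frame_fix n (s : n.-tuple (proj_point V)) Q x g :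
  frame s Q x -> (forall P, P \in s -> g P = P) -> g Q = Q -> g = 1%g.
Proof.
move=> sQx gs gQ; have [u u0 gu] := PGL_linear g.
have gs1 i : g (tnth s i) = tnth s ((1%g : 'S_n) i) by rewrite perm1 gs ?mem_tnth.
have [c c0 ux] := frame_perm sQx u0 gu gs1 gQ.
have uc v : u v = c *: v.
  have [_ _ _ /(_ v)[k ->]] := sQx; rewrite linear_sum scaler_sumr /=.
  by apply: eq_bigr => i _; rewrite linearZ /= ux perm1 !scalerA mulrC.
apply: PGL_ext => P; apply: val_inj; rewrite gu /=.
have [y y0 Py] := proj_pointP P; rewrite [val P]Py limg_line uc -Py.
by apply/esym/line_eq; rewrite ?scaler_eq0 ?negb_or ?c0 // Py memvZ ?memv_line.
Qed.

End Points.

(** * The action of [G] on its orbit [X] *)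

Section SymmetricAction.
Variables (R : fieldType) (V : vectType R).
Variables (m : nat) (G : set (PGL V)) (X : {fset proj_point V}).
Hypotheses (G_Sym : isomorphic_to_Sym G m)
  (X_orbit : exists P : proj_point V, [set` X]%classic = PGL_orbit G P)
  (G_faithful : acts_faithfully G X)
  (card_X : #|` X|%fset = m).

(* [{multiplicative _ -> _}] only asks for a morphism of magmas. *)
Lemma multiplicative1 (gT hT : groupType) (f : {multiplicative gT -> hT}) :
  f 1%g = 1%g.
Proof. by apply: (mulIg (f 1%g)); rewrite -gmulfM !mul1g. Qed.

Lemma group_mulV g h : G g -> G h -> G (g^-1 * h)%g.
Proof.
case: G_Sym => phi _ <- [s _ <-] [t _ <-].
exists (s^-1 * t)%g => //; rewrite gmulfM; congr (_ * _)%g.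
by apply: (mulIg (phi s)); rewrite mulVg -gmulfM mulVg multiplicative1.
Qed.

Lemma orbit_stable g P : G g -> P \in X -> g P \in X.
Proof.
case: X_orbit => P0 XE; case: G_Sym => phi _ GE Gg PX.
have : [set` X]%classic P by [].
rewrite XE => -[h Gh <-].
suff : [set` X]%classic ((g * h)%g P0) by [].
rewrite XE; exists (g * h)%g => //; move: Gg Gh; rewrite -GE.
by move=> [s _ <-] [t _ <-]; exists (s * t)%g => //; rewrite gmulfM.
Qed.

Lemma eq_on_orbit g h : G g -> G h -> (forall P, P \in X -> g P = h P) -> g = h.
Proof.
move=> Gg Gh gh; apply: (mulgI (h^-1)%g); rewrite mulVg.
apply: G_faithful => [|P PX]; first exact: group_mulV.
by rewrite -[LHS]/((h^-1)%g (g P)) gh // -[LHS]/((h^-1 * h)%g P) mulVg.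
Qed.

Lemma orbit_perm g : G g -> exists s : {perm X}, extends g s.
Proof.
move=> Gg; pose f (P : X) : X := [` orbit_stable Gg (valP P)]%fset.
have f_inj : injective f.
  by move=> P Q /(congr1 val) /= /PGL_inj /val_inj.
by exists (perm f_inj) => P; rewrite permE.
Qed.

(* Both groups have order m!, so the injection of G into the permutations of X
   is onto. *)
Lemma orbit_perm_surj (s : {perm X}) : exists2 g, G g & extends g s.
Proof.
case: (G_Sym) => phi phi_inj GE.
have Gphi t : G (phi t) by rewrite -GE; exists t.
pose rho t : {perm X} := sval (cid (orbit_perm (Gphi t))).
have rhoP t : extends (phi t) (rho t) by apply: (svalP (cid _)).
have rho_inj : injective rho.
  move=> t1 t2 E; apply: phi_inj; apply: eq_on_orbit => // P PX.
  by rewrite -[P]/(val [` PX]%fset) !rhoP E.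
have card_perms : (#|{perm X}| <= #|'S_m|)%N.
  have := card_perm [set: X]; rewrite cardsT -cardfE card_X card_Sn => <-.
  apply: subset_leq_card.
  by apply/fintype.subsetP => p _; apply/fintype.subsetP => x _; rewrite inE.
have [sig _ sigK] := inj_card_bij rho_inj card_perms.
by exists (phi (sig s)) => //; rewrite -[s in extends _ s]sigK.
Qed.

(** The source of all elements of [G] used below on points outside a frame. [P] and [Q] may
    coincide, which spares case distinctions. *)
Lemma orbit_swap P Q : P \in X -> Q \in X -> exists g, [/\ G g, g P = Q, g Q = P
  & forall Z, Z \in X -> Z != P -> Z != Q -> g Z = Z].
Proof.
move=> PX QX; pose P' : X := [` PX]%fset; pose Q' : X := [` QX]%fset.
have [g Gg gs] := orbit_perm_surj (tperm P' Q').
exists g; split=> // [||Z ZX ZP ZQ].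
- by rewrite -[P]/(val P') gs tpermL.
- by rewrite -[Q]/(val Q') gs tpermR.
have := gs [` ZX]%fset; rewrite tpermD // -(inj_eq val_inj) eq_sym.
- exact: ZP.
- exact: ZQ.
Qed.

(** * Irreducibility and general position *)

Hypothesis (G_irr : forall S : {vspace V}, PGL_invariant G S -> S = 0%VS \/ S = fullv).

(** The join of an orbit is invariant, and it is non-zero because the orbit is non-empty. *)
Lemma join_orbit : join X = fullv.
Proof.
case: (G_irr (S := join X)) => // [g Gg|X0].
  have [u u0 gu] := PGL_linear g.
  have uX : (u @: join X)%VS = join X.
    apply/eqP; rewrite eqEdim (limg_join _ gu) dim_join_map leqnn andbT.
    apply: join_sub => _ /mapP[P PX ->].
    by apply: sub_join; apply: orbit_stable.
  apply/seteqP; split=> [_ [P /= PX <-]|P PX] /=.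
    by rewrite /proj_points /= gu -uX; apply: limgS.
  exists ((g^-1)%g P); last by rewrite -[LHS]/((g * g^-1)%g P) mulgV.
  (* As [u] is injective and preserves [join X], the inclusion may be tested after applying [u]. *)
  rewrite /proj_points /= -(limg_ker0 _ _ u0) -gu uX.
  by rewrite -[g _]/((g * g^-1)%g P) mulgV.
case: X_orbit => P XE; have PX : P \in X.
  suff : [set` X]%classic P by [].
  rewrite XE; exists 1%g => //; case: G_Sym => phi _ <-.
  by exists 1%g; rewrite ?multiplicative1.
have := sub_join PX; rewrite X0 subv0 -dimv_eq0.
by rewrite (eqP (valP P)).
Qed.

(** Some [t] inside [X] is a basis; a permutation of [X] carries [t] to [s], and an element of [G]
    inducing it preserves dimensions of joins. *)
Lemma general_position (s : seq (proj_point V)) :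
  uniq s -> {subset s <= X} -> size s = \dim {:V} -> join s = fullv.
Proof.
move=> us sX szs; have [t [tX jt dt]] := exists_basis X.
rewrite join_orbit in jt; have ut := subseq_uniq tX (fset_uniq X).
(* Permutations act on the finite type attached to [X], so both sequences are lifted to it. *)
have lift (r : seq (proj_point V)) : {subset r <= X} ->
    exists r' : seq X, map val r' = r.
  elim: r => [|P r IHr] rX; first by exists [::].
  have [r' <-] : exists r' : seq X, map val r' = r.
    by apply: IHr => Q Qr; apply: rX; rewrite inE Qr orbT.
  have PX : P \in X by apply: rX; rewrite mem_head.
  by exists ([` PX]%fset :: r').
have [s' sE] := lift _ sX; have [t' tE] := lift _ (mem_subseq tX).
have szst : size t' = size s'.
  by rewrite -(size_map val s') sE -(size_map val t') tE szs -dt jt.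
have [||p pE] := @perm_map_seq _ t' s' _ _ szst.
- by rewrite -(map_inj_uniq val_inj) tE.
- by rewrite -(map_inj_uniq val_inj) sE.
have [g _ gp] := orbit_perm_surj p.
have gts : map g t = s.
  by rewrite -tE -sE -pE -!map_comp; apply: eq_map => P /=; rewrite gp.
by apply/eqP; rewrite eqEdim subvf -gts dim_join_map jt leqnn.
Qed.

Lemma not_sub_join P s : uniq (P :: s) -> {subset P :: s <= X} ->
  (size s).+1 = \dim {:V} -> ~ (val P <= join s)%VS.
Proof.
move=> uPs PsX szs /addv_idPr Ps; have := general_position uPs PsX szs.
rewrite join_cons Ps => js; have := dim_join_le s.
by rewrite js -szs ltnn.
Qed.

(** * Frames inside the orbit *)

Local Notation n := (\dim {:V}).

(** If [a i] were 0, [Q] would lie in the join of the n - 1 other points of [s], against general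
    position. *)
Lemma frame_coef_neq0 (s : n.-tuple (proj_point V)) Q (y : 'I_n -> V)
    (a : 'I_n -> R) i :
  uniq (Q :: s) -> {subset Q :: s <= X} ->
  (forall i, val (tnth s i) = <[y i]>%VS) ->
  val Q = <[\sum_i a i *: y i]>%VS -> a i != 0.
Proof.
move=> /andP[Qs us] QsX yE Qq; apply/eqP => ai0.
pose r := [seq tnth s j | j in predC1 i].
apply: (@not_sub_join Q r).
- rewrite /= map_inj_uniq ?enum_uniq ?andbT; last exact/tuple_uniqP.
  by apply: contra Qs => /mapP[j _ ->]; apply: mem_tnth.
- move=> P; rewrite inE => /orP[/eqP->|/mapP[j _ ->]].
    exact/QsX/mem_head.
  by apply: QsX; rewrite inE mem_tnth orbT.
- rewrite size_map -cardE cardC1 card_ord prednK //.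
  exact: leq_ltn_trans (ltn_ord i).
rewrite Qq -memvE; apply: memv_suml => j _.
have [->|ji] := eqVneq j i; first by rewrite ai0 scale0r mem0v.
apply: memvZ; rewrite memvE -yE; apply: sub_join.
by apply: map_f; rewrite mem_enum.
Qed.

Lemma exists_frame (s : n.-tuple (proj_point V)) Q :
  uniq (Q :: s) -> {subset Q :: s <= X} -> exists x, frame s Q x.
Proof.
move=> /andP[Qs us] QsX.
have sX : {subset s <= X} by move=> P Ps; apply: QsX; rewrite inE Ps orbT.
have QX : Q \in X by apply: QsX; rewrite mem_head.
pose y i := vpick (val (tnth s i)).
have y0 i : y i != 0 by rewrite vpick0 -dimv_eq0 (eqP (valP (tnth s i))).
have yE i : val (tnth s i) = <[y i]>%VS by apply: line_eq (memv_pick _) (y0 i).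
pose b := [tuple y i | i < n].
have bi (i : 'I_n) : b`_i = y i by rewrite -tnth_nth tnth_mktuple.
have spanb : <<b>>%VS = fullv.
  rewrite -[RHS](general_position us sX (size_tuple s)) span_def /join.
  rewrite big_map big_enum /= big_tuple.
  by apply: eq_bigr => i _; rewrite yE.
have freeb : free b by rewrite /free spanb size_tuple.
have [q q0 Qq] := proj_pointP Q.
have coordb v : v = \sum_i coord b i v *: y i.
  have vb : v \in <<b>>%VS by rewrite spanb memvf.
  by rewrite {1}(coord_span vb); apply: eq_bigr => i _; rewrite bi.
have c0 i : coord b i q != 0.
  apply: (@frame_coef_neq0 s Q y (fun i => coord b i q)) => //; last by rewrite -coordb.
  exact/andP.
(* Rescaling by the coordinates of [q], all non-zero, turns [q] into the unit vector. *)
exists (fun i => coord b i q *: y i); split=> [i||k k0 i|v].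
- apply: line_eq; last by rewrite scaler_eq0 negb_or c0 y0.
  by rewrite yE memvZ ?memv_line.
- by rewrite Qq {1}(coordb q).
- apply: (mulIf (c0 i)); rewrite mul0r.
  move/freeP: freeb => /(_ (fun i => k i * coord b i q)); apply.
  by rewrite -[RHS]k0; apply: eq_bigr => j _; rewrite bi scalerA.
exists (fun i => coord b i v / coord b i q); rewrite {1}(coordb v).
by apply: eq_bigr => i _; rewrite scalerA divfK.
Qed.

(** If [g] extends a permutation that [h] in [G] also induces, then [h^-1 * g] fixes a frame, so
    [g = h]. *)
Lemma orbit_eq_GX (s : n.-tuple (proj_point V)) Q x :
  {subset Q :: s <= X} -> frame s Q x -> G = GX X.
Proof.
move=> QsX sQx; apply/seteqP; split=> [g|g [p gp]]; first exact: orbit_perm.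
have [h Gh hp] := orbit_perm_surj p.
suff -> : g = h by [].
have hg P : P \in X -> (h^-1 * g)%g P = P.
  move=> PX; rewrite -[LHS]/((h^-1)%g (g P)).
  have := gp [` PX]%fset; have := hp [` PX]%fset; rewrite /= => <- ->.
  by rewrite -[LHS]/((h^-1 * h)%g P) mulVg.
apply: (mulgI (h^-1)%g); rewrite mulVg; apply: (frame_fix sQx) => [P Ps|].
  by apply/hg/QsX; rewrite inE Ps orbT.
exact/hg/QsX/mem_head.
Qed.

(* The transposition of two points outside a frame fixes the frame. *)
Lemma frame_extra_unique (s : n.-tuple (proj_point V)) Q Q' Q'' x :
  uniq (Q :: s) -> {subset Q :: s <= X} -> frame s Q x ->
  Q' \in X -> Q'' \in X -> Q' \notin Q :: s -> Q'' \notin Q :: s -> Q' = Q''.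
Proof.
move=> uQs QsX sQx Q'X Q''X nQ' nQ''.
have [g [_ gQ' _ gfix]] := orbit_swap Q'X Q''X.
have fixQs P : P \in Q :: s -> g P = P.
  move=> PQs; apply: gfix; first exact: QsX.
    by apply: contraNneq nQ' => <-.
  by apply: contraNneq nQ'' => <-.
suff g1 : g = 1%g by rewrite -gQ' g1.
apply: (frame_fix sQx) => [P Ps|]; apply: fixQs; last exact: mem_head.
by rewrite inE Ps orbT.
Qed.

(** * A further point outside a frame and its unit point *)

Lemma frame_coef_neq (s : n.-tuple (proj_point V)) Q Q' x (a : 'I_n -> R) i j :
  uniq (Q' :: Q :: s) -> {subset Q' :: Q :: s <= X} -> frame s Q x ->
  val Q' = <[\sum_i a i *: x i]>%VS -> i != j -> a i != a j.
Proof.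
move=> /and3P[nQ' Qs us] QsX [sx Qx _ _] Q'x ij; apply/eqP => aij.
pose r := [seq tnth s k | k in predC (pred2 i j)].
have rs P : P \in r -> P \in val s by move=> /mapP[k _ ->]; apply: mem_tnth.
apply: (@not_sub_join Q' (Q :: r)).
- rewrite /= map_inj_uniq ?enum_uniq ?andbT; last exact/tuple_uniqP.
  rewrite (contra (@rs Q) Qs) andbT; apply: contra nQ'.
  by rewrite !inE => /orP[->//|/rs ->]; rewrite orbT.
- move=> P; rewrite 2!inE => /or3P[PQ|PQ|/rs Ps]; apply: QsX; rewrite !inE.
  + by rewrite PQ.
  + by rewrite PQ orbT.
  + by do ?[apply/orP; right].
- rewrite /= size_map -cardE -[RHS]card_ord -(cardC (pred2 i j)) card2 ij.
  by rewrite addSn addSn add0n.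
rewrite Q'x -memvE.
(* Subtracting [a i] times the unit vector kills the terms at [i] and [j], so [Q'] lies in the join
   of [Q] and n - 2 points of [s]. *)
have -> : \sum_k a k *: x k = a i *: \sum_k x k + \sum_k (a k - a i) *: x k.
  rewrite scaler_sumr -big_split; apply: eq_bigr => k _ /=.
  by rewrite scalerBl addrCA subrr addr0.
rewrite join_cons; apply: memv_add; first by rewrite Qx memvZ ?memv_line.
apply: memv_suml => k _; have [/orP[]|kij] := boolP (pred2 i j k).
- by move/eqP->; rewrite subrr scale0r mem0v.
- by move/eqP->; rewrite aij subrr scale0r mem0v.
apply: memvZ; rewrite memvE -sx; apply: sub_join.
by apply: map_f; rewrite mem_enum.
Qed.

Lemma two_extra (s : n.-tuple (proj_point V)) Q Q' x :
  (2 <= n)%N -> uniq (Q' :: Q :: s) -> {subset Q' :: Q :: s <= X} ->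
  frame s Q x ->
  exists i j, [/\ i != j, forall k : 'I_n, k = i \/ k = j
    & val Q' = <[x i - x j]>%VS].
Proof.
move=> n2 uQs QsX sQx; have [sx Qx xfree xspan] := sQx.
have [q q0 Q'q] := proj_pointP Q'; have [a qa] := xspan q.
rewrite qa in Q'q.
have /and3P[nQ' nQ us] := uQs.
pose i : 'I_n := Ordinal (ltnW n2); pose j : 'I_n := Ordinal n2.
have ij : i != j by [].
have sX k : tnth s k \in X.
  by apply: QsX; do 2!(rewrite inE; apply/orP; right); apply: mem_tnth.
have [g [_ gi gj gfix]] := orbit_swap (sX i) (sX j).
have [u u0 gu] := PGL_linear g.
have gs k : g (tnth s k) = tnth s (tperm i j k).
  case: tpermP => [->|->|/eqP ki /eqP kj] //; apply: gfix => //.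
    by rewrite (inj_eq (tuple_uniqP _ us)).
  by rewrite (inj_eq (tuple_uniqP _ us)).
have s_neq k P : P \notin val s -> P != tnth s k.
  by apply: contraNneq => ->; apply: mem_tnth.
have nQ's : Q' \notin val s by apply: contra nQ'; rewrite inE orbC => ->.
have gQ : g Q = Q.
  by apply: gfix; rewrite ?s_neq //; apply: QsX; rewrite !inE eqxx orbT.
have gQ' : g Q' = Q'.
  by apply: gfix; rewrite ?s_neq //; apply: QsX; rewrite !inE eqxx.
have [c c0 ux] := frame_perm sQx u0 gu gs gQ.
have [d ud] := PGL_lineP u0 gu gQ' Q'q Q'q.
(* Coefficients are compared in [u q = d *: q], where [u] is [c] times the swap of coordinates [i]
   and [j]. *)
have cd k : c * a (tperm i j k) = d * a k.
  apply/eqP; rewrite -subr_eq0; apply/eqP; move: k.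
  apply: (xfree (fun k => c * a (tperm i j k) - d * a k)).
  under eq_bigr do rewrite scalerBl; rewrite sumrB; apply/eqP; rewrite subr_eq0.
  under [X in _ == X]eq_bigr do rewrite -scalerA.
  rewrite -scaler_sumr -ud linear_sum; apply/eqP => /=.
  rewrite [RHS](reindex_inj (@perm_inj _ (tperm i j))); apply: eq_bigr => k _.
  by rewrite linearZ /= ux tpermK scalerA mulrC.
have aij := frame_coef_neq uQs QsX sQx Q'q ij.
have ai0 k : a k != 0.
  apply: (@frame_coef_neq0 s Q' x) => //; first exact/andP.
  move=> P; rewrite inE => /orP[PQ|Ps]; apply: QsX; rewrite !inE ?PQ //.
  by do ?[apply/orP; right].
(* A third index would give [c = d], and then [a i = a j]. *)
have cji := cd i; have cij := cd j; rewrite tpermL in cji; rewrite tpermR in cij.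
have all_ij k : k = i \/ k = j.
  have [->|ki] := eqVneq k i; first by left.
  have [->|kj] := eqVneq k j; first by right.
  have := cd k; rewrite tpermD 1?eq_sym // => /(mulIf (ai0 k)) E.
  by move: cij aij; rewrite -E => /(mulfI c0) ->; rewrite eqxx.
exists i, j; split=> //.
(* The relations at [i] and [j] give equal squares, and [a i], [a j] are distinct. *)
have aji : a j = - a i.
  have : a j ^+ 2 == a i ^+ 2.
    apply/eqP/(mulfI c0); rewrite !expr2 !mulrA cji cij.
    by rewrite mulrAC.
  by rewrite eqf_sqr eq_sym (negPf aij) => /eqP.
have qE : q = a i *: (x i - x j).
  rewrite qa (bigD1 i) //= (bigD1 j) 1?eq_sym //= big1 => [|k /andP[ki kj]].
    by rewrite addr0 aji scaleNr -scalerBr.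
  by case: (all_ij k) ki kj => ->; rewrite eqxx.
apply: line_eq; last by apply: contraNneq q0 => xij; rewrite qE xij scaler0.
by rewrite Q'q -qa qE; apply/vlineP; exists (a i)^-1; rewrite scalerA mulVf ?scale1r.
Qed.

Lemma extra_harmonic (s : n.-tuple (proj_point V)) Q Q' x :
  (2 <= n)%N -> uniq (Q' :: Q :: s) -> {subset Q' :: Q :: s <= X} ->
  frame s Q x -> harmonic X /\ 3%N \in [pchar R].
Proof.
move=> n2 uQs QsX sQx.
have [i [j [ij all_ij Q'x]]] := two_extra n2 uQs QsX sQx.
have [sx Qx xfree xspan] := sQx.
have /and3P[nQ' nQ us] := uQs.
have sum2 (W : nmodType) (f : 'I_n -> W) : \sum_k f k = f i + f j.
  rewrite (bigD1 i) //= (bigD1 j) 1?eq_sym //= big1 => [|k /andP[ki kj]].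
    by rewrite addr0.
  by case: (all_ij k) ki kj => ->; rewrite eqxx.
have xind k l k' l' :
    k *: x i + l *: x j = k' *: x i + l' *: x j -> k = k' /\ l = l'.
  move=> E; have := xfree (fun t => if t == i then k - k' else l - l').
  rewrite sum2 eqxx eq_sym (negPf ij) !scalerBl addrACA -opprD E subrr.
  move=> /(_ erefl) H; split; apply/eqP; rewrite -subr_eq0; apply/eqP.
    by have := H i; rewrite eqxx.
  by have := H j; rewrite eq_sym (negPf ij).
have Qij : val Q = <[x i + x j]>%VS by rewrite Qx sum2.
have mem_s k : tnth s k \in val s by apply: mem_tnth.
have mem_Qs P : P \in val s -> P \in X.
  by move=> Ps; apply: QsX; do 2!(rewrite inE; apply/orP; right).
have QX : Q \in X by apply: QsX; rewrite !inE eqxx orbT.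
have Q'X : Q' \in X by apply: QsX; rewrite !inE eqxx.
have nQ's : Q' \notin val s by apply: contra nQ'; rewrite inE orbC => ->.
have uQ : uniq (Q :: s) by exact/andP.
have QsX1 : {subset Q :: s <= X}.
  by move=> P Ps; apply: QsX; rewrite inE Ps orbT.
split.
  exists (x i), (x j); split.
    have dimn : n = 2%N.
      (* [card2] counts a pair as [(i != j).+1], so 2 is first written in that shape. *)
      rewrite -[LHS]card_ord -[2%N]/((true : bool).+1) -ij -card2.
      by apply: eq_card => k; rewrite !inE; case: (all_ij k) => ->;
        rewrite eqxx ?orbT.
    suff E : <<[:: x i; x j]>>%VS = fullv by rewrite /free E dimn.
    apply/eqP; rewrite eqEsubv subvf; apply/subvP => v _.
    have [k ->] := xspan v; rewrite sum2 rpredD // memvZ // memv_span //;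
      by rewrite !inE eqxx ?orbT.
  rewrite -!sx -Qij -Q'x.
  apply: imfset4 => //; [exact: mem_Qs | exact: mem_Qs | move=> P PX].
  have [|nPQs] := boolP (P \in Q :: s); last first.
    by constructor 4; apply: frame_extra_unique uQ QsX1 sQx PX Q'X nPQs nQ'.
  rewrite inE => /orP[/eqP->|/tnthP[k ->]]; first by constructor 3.
  by case: (all_ij k) => ->; [constructor 1 | constructor 2].
(* Swapping [<[x i]>] with [Q] fixes [<[x j]>] and [Q']. Additivity of [u] on [x i + x j] gives
   [b = - a], and on [x i - x j] it gives [a - b = - a]; hence 3a = 0 with [a] non-zero. *)
have [g [_ gi gQ gfix]] := orbit_swap (mem_Qs _ (mem_s i)) QX.
have [u u0 gu] := PGL_linear g.
have s_neq k P : P \notin val s -> tnth s k != P.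
  by apply: contraNneq => <-.
have gj : g (tnth s j) = tnth s j.
  apply: gfix; [exact: mem_Qs | | exact: s_neq].
  by rewrite (inj_eq (tuple_uniqP _ us)) eq_sym.
have gQ' : g Q' = Q'.
  apply: gfix => //; first by rewrite eq_sym s_neq.
  by apply: contraNneq nQ' => ->; rewrite mem_head.
have [a ua] := PGL_lineP u0 gu gi (sx i) Qij.
have [b ub] := PGL_lineP u0 gu gj (sx j) (sx j).
have [c uc] := PGL_lineP u0 gu gQ Qij (sx i).
have [d ud] := PGL_lineP u0 gu gQ' Q'x Q'x.
have [_ ab0] : a = c /\ a + b = 0.
  have := uc; rewrite linearD /= ua ub => E.
  by apply: xind; rewrite scale0r addr0 -E scalerDl scalerDr addrA.
have [ad abd] : a = d /\ a - b = - d.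
  have := ud; rewrite linearB /= ua ub scalerBr => E.
  by apply: xind; rewrite scaleNr -E scalerBl scalerDr addrA.
have a0 : a != 0.
  apply: contraTneq (valP (tnth s i)) => a0; rewrite sx dim_vline.
  suff -> : x i = 0 by rewrite eqxx.
  by move/lker0P: u0; apply; rewrite linear0 ua a0 scale0r.
have bE : b = - a by apply/eqP; rewrite -addr_eq0 addrC ab0.
rewrite inE /= -(mulrI_eq0 _ (mulfI a0)) mulr_natr mulrS mulr2n.
by move: abd; rewrite bE opprK -ad => ->; rewrite subrr.
Qed.

End SymmetricAction.

Local Close Scope ring_scope.

Theorem corollary2 (R : fieldType) (V : vectType R)
    (dimV_ge2 : (2 <= \dim {:V})%N)
    (m : nat) (G : set (PGL V))
    (G_group : group_closed (mem G))
    (G_Sym : isomorphic_to_Sym G m)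
    (X : {fset proj_point V})
    (X_orbit : exists P : proj_point V, [set` X]%classic = PGL_orbit G P)
    (G_faithful : acts_faithfully G X)
    (card_X : #|` X|%fset = m)
    (G_irr : forall S : {vspace V}, PGL_invariant G S -> S = 0%VS \/ S = fullv) :
  [\/ maximal_independent X,
      simplex X
    | harmonic X /\ 3 \in [pchar R]%R] /\
  (~ independent X -> is_GX G X).
Proof.
have joinX := join_orbit G_Sym X_orbit G_irr.
have [indX|ndX] := pselect (independent X).
  split=> [|//]; constructor 1; split=> //.
  by rewrite -joinX; apply/esym/independentP.
have [t [tX jt dt]] := exists_basis X.
have ut := subseq_uniq tX (fset_uniq X).
have szt : size t == \dim {:V} by rewrite -dt jt joinX.
pose s : (\dim {:V}).-tuple (proj_point V) := Tuple szt.
(* Since [X] is dependent, the basis [t] misses a point of [X], which serves as unit point. *)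
have ltX : (size t < #|` X|%fset)%N.
  rewrite -dt jt ltn_neqAle dim_join_le andbT.
  by apply/eqP => /independentP.
have [Q QX Qt] : exists2 Q, Q \in X & Q \notin t.
  apply: contrapT => noQ; suff Xt : {subset X <= t}.
    by move: ltX; rewrite ltnNge (uniq_leq_size (fset_uniq X) Xt).
  by move=> Q QX; apply: contrapT => /negP Qt; apply: noQ; exists Q.
have uQs : uniq (Q :: s) by apply/andP.
have QsX : {subset Q :: s <= X}.
  by move=> P; rewrite inE => /orP[/eqP->//|/(mem_subseq tX)].
have [x sQx] := exists_frame G_Sym X_orbit G_faithful card_X G_irr uQs QsX.
(* This settles the equality in (2), leaving only [has_GX X] to establish in each case. *)
have GE := orbit_eq_GX G_Sym X_orbit G_faithful card_X QsX sQx.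
(* With no further point [X] has n + 1 elements, and general position makes it a simplex; otherwise
   [extra_harmonic] applies. *)
have [XQs|nXQs] := pselect {subset X <= Q :: s}.
  suff smpX : simplex X by split=> [|_]; [constructor 2 | split=> //; left].
  split=> // [|Y YX cY].
    apply/eqP; rewrite eqn_leq -{1}(eqP szt) (uniq_leq_size (fset_uniq X) XQs).
    by rewrite -(eqP szt).
  apply/independentP.
  rewrite (general_position G_Sym X_orbit G_faithful card_X G_irr) ?fset_uniq //.
  by move=> P PY; apply: (fsubsetP YX).
have [Q' Q'X nQ'] : exists2 Q', Q' \in X & Q' \notin Q :: s.
  apply: contrapT => noQ; apply: nXQs => Q' Q'X.
  by apply: contrapT => /negP nQ'; apply: noQ; exists Q'.
have uQ's : uniq (Q' :: Q :: s) by apply/andP.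
have Q'sX : {subset Q' :: Q :: s <= X}.
  by move=> P; rewrite inE => /orP[/eqP->//|/QsX].
have [hX char3] := extra_harmonic G_Sym X_orbit G_faithful card_X G_irr
  dimV_ge2 uQ's Q'sX sQx.
split=> [|_]; first by constructor 3.
split=> //; right; split=> // S SX; apply/eqP; rewrite eqEsubv subvf -joinX.
by apply: join_sub => P /SX.
Qed.
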